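(* Let $\Gamma$ be a finite, simple, connected, undirected tree with adjacency matrix $A(\Gamma)$, and let $n$ be a nonnegative integer. The following are equivalent: (1) the length of the longest path of $\Gamma$ is $n$; (2) $\beta(A(\Gamma)^{n+1})=\beta(A(\Gamma)^{n-1})$, and $n$ is the minimum number with this property. Equivalently, the length of the longest path of $\Gamma$ equals $\mathfrak{D}(\Gamma)=\min\{n \mid \beta(A(\Gamma)^{n+1})=\beta(A(\Gamma)^{n-1})\}$.
   Context: For a square matrix $Q$, $\beta(Q)$ is the $(0,1)$-matrix with $\beta(Q)_{i,j}=1$ if $Q_{i,j}\ne 0$ and $0$ otherwise. $A(\Gamma)_{i,j}=1$ iff $\{v_i,v_j\}$ is an edge, else $0$; $A(\Gamma)^0$ is the identity matrix. A path is a sequence of distinct vertices in which consecutive vertices are adjacent; its length is its number of edges.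
   Formalization: At n=0 the power A^{n-1}=A^{-1}, undefined in general (and giving a false claim for the single-edge tree if read as the inverse), is taken to be the zero matrix; for trees with an edge this is the same as taking the minimum over n≥1. *)

(* Defs.v *)
From mathcomp Require Import all_boot all_order all_algebra.

Set Implicit Arguments.
Unset Strict Implicit.
Unset Printing Implicit Defensive.

Import GRing.Theory.
Local Open Scope ring_scope.

Definition beta (R : nzRingType) (m : nat) (Q : 'M[R]_m) : 'M[R]_m :=
  \matrix_(i, j) (Q i j != 0)%:R.

(* The vertices are numbered v_i = enum_val i. *)
Definition adjacency (V : finType) (e : rel V) : 'M[int]_#|V| :=
  \matrix_(i, j) (e (enum_val i) (enum_val j))%:R.

Definition simple_graph (V : finType) (e : rel V) : Prop :=
  symmetric e /\ irreflexive e.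

Definition connected_graph (V : finType) (e : rel V) : Prop :=
  (0 < #|V|)%N /\ forall x y : V, connect e x y.

(* A ucycle with one vertex would be a loop, and one with two vertices is an
   edge traversed back and forth: graph cycles have at least three vertices. *)
Definition acyclic_graph (V : finType) (e : rel V) : Prop :=
  forall c : seq V, ucycle e c -> (size c < 3)%N.

Definition tree (V : finType) (e : rel V) : Prop :=
  [/\ simple_graph e, connected_graph e & acyclic_graph e].

(* The path with vertex sequence x :: p has size p edges. *)
Definition graph_path (V : finType) (e : rel V) (x : V) (p : seq V) : bool :=
  path e x p && uniq (x :: p).

Definition longest_path_length (V : finType) (e : rel V) (n : nat) : Prop :=
  (exists x p, graph_path e x p /\ size p = n) /\
  (forall x p, graph_path e x p -> (size p <= n)%N).

(* The power A ^ (n - 1) for n : nat.  At n = 0 the exponent -1 does not stand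
   for a matrix inverse (the adjacency matrix of a tree may be singular): entry
   (i, j) of A ^ k counts the walks of length k from v_i to v_j, and there is
   no walk of length -1, so the value is the zero matrix.  For a tree with an
   edge, n = 0 then never satisfies beta_stable; for the one-vertex tree it
   does. *)
Definition pow_pred (R : nzRingType) (m : nat) (A : 'M[R]_m) (n : nat) :
    'M[R]_m :=
  if n is k.+1 then A ^+ k else 0.

Definition beta_stable (V : finType) (e : rel V) (n : nat) : Prop :=
  beta (adjacency e ^+ n.+1) = beta (pow_pred (adjacency e) n).

Definition is_minimum (P : nat -> Prop) (n : nat) : Prop :=
  P n /\ forall k : nat, P k -> (n <= k)%N.

(* D(Gamma) = d, as a relation: this includes that the set of which the
   minimum is taken is nonempty. *)
Definition frakD (V : finType) (e : rel V) (d : nat) : Prop :=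
  is_minimum (beta_stable e) d.

(* Main.v *)
(** Entry (i, j) of [A ^+ k] is nonzero iff there is a walk of length k from v_i
    to v_j.  In a tree, a walk that repeats a vertex contains a backtrack
    u, w, u, and deleting it gives a walk two steps shorter: every walk longer
    than the longest path can be shortened.  Conversely, walks are lengthened by
    a backtrack at their end.  Minimality holds because the only path joining
    two vertices is also the shortest walk, so that the ends of a path of length
    k + 1 are not joined by a walk of length k - 1. *)
Require Import Defs.
From mathcomp Require Import all_boot all_order all_algebra.

Set Implicit Arguments.
Unset Strict Implicit.
Unset Printing Implicit Defensive.

Import Order.TTheory GRing.Theory Num.Theory.

Definition walk (V : finType) (e : rel V) (k : nat) (x y : V) : Prop :=
  exists p, [/\ path e x p, last x p = y & size p = k].

Lemma walkS (V : finType) (e : rel V) (k : nat) (x y : V) :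
  walk e k.+1 x y <-> exists2 z, e x z & walk e k z y.
Proof.
split=> [[[|z p] []] // /= /andP[exz zp] lp [sp]|[z exz [p [zp lp sp]]]].
  by exists z => //; exists p.
by exists (z :: p); rewrite /= exz sp.
Qed.

Section Powers.
Local Open Scope ring_scope.
Variables (V : finType) (e : rel V).

Lemma adjacency_pow_ge0 (k : nat) (i j : 'I_#|V|) :
  0 <= (adjacency e ^+ k) i j.
Proof.
elim: k i j => [|k IHk] i j; first by rewrite expr0 mxE ler0n.
rewrite exprS mxE; apply: sumr_ge0 => l _.
by rewrite mulr_ge0 // mxE ler0n.
Qed.

(** All terms of the matrix product are nonnegative, so nothing cancels: the sum is nonzero exactly
    when some first step [l] contributes a nonzero term. *)
Lemma adjacency_pow_neq0 (k : nat) (i j : 'I_#|V|) :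
  (adjacency e ^+ k) i j != 0 <-> walk e k (enum_val i) (enum_val j).
Proof.
elim: k i j => [|k IHk] i j.
  rewrite expr0 mxE pnatr_eq0 eqb0 negbK; split=> [/eqP->|[[|z p] [] //= _]].
    by exists [::].
  by move/enum_val_inj=> ->.
have term_ge0 l : true -> 0 <= adjacency e i l * (adjacency e ^+ k) l j.
  by rewrite mulr_ge0 ?adjacency_pow_ge0 // mxE ler0n.
rewrite exprS mxE psumr_neq0 //; split.
  case/hasP=> l _ /= /lt0r_neq0; rewrite mulf_eq0 negb_or => /andP[].
  rewrite mxE pnatr_eq0 eqb0 negbK => eil /IHk wl.
  by apply/walkS; exists (enum_val l).
case/walkS=> z eiz wz; apply/hasP; exists (enum_rank z); first exact: mem_index_enum.
rewrite /= lt0r term_ge0 // andbT mulf_neq0 //.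
  by rewrite mxE enum_rankK eiz.
by apply/IHk; rewrite enum_rankK.
Qed.

Lemma beta_eqP (m : nat) (P Q : 'M[int]_m) :
  beta P = beta Q <-> forall i j, (P i j != 0) = (Q i j != 0).
Proof.
split=> [/matrixP eqPQ i j|eqPQ]; last by apply/matrixP=> i j; rewrite !mxE eqPQ.
have := eqPQ i j; rewrite !mxE => /eqP; rewrite eqr_nat.
by case: (_ != 0) (_ != 0) => [] [].
Qed.

Lemma beta_stable0P :
  beta_stable e 0 <-> forall x y, ~~ e x y.
Proof.
split=> [/beta_eqP st x y|noe]; last apply/beta_eqP=> i j.
  have := st (enum_rank x) (enum_rank y).
  by rewrite expr1 !mxE !enum_rankK pnatr_eq0 eqb0 negbK eqxx => ->.
by rewrite expr1 !mxE (negbTE (noe _ _)) eqxx.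
Qed.

Lemma beta_stableSP (k : nat) :
  beta_stable e k.+1 <-> forall x y, walk e k.+2 x y <-> walk e k x y.
Proof.
split=> [/beta_eqP st x y|st]; last apply/beta_eqP=> i j.
  rewrite -(enum_rankK x) -(enum_rankK y).
  have /= stxy := st (enum_rank x) (enum_rank y).
  by split=> /adjacency_pow_neq0 w; apply/adjacency_pow_neq0; move: w; rewrite stxy.
by apply/idP/idP=> /adjacency_pow_neq0/st/adjacency_pow_neq0.
Qed.

End Powers.

Section Trees.
Variables (V : finType) (e : rel V).
Hypotheses (sym_e : symmetric e) (irr_e : irreflexive e).
Hypothesis acyclic_e : acyclic_graph e.

(** Shortened to a path, the walk [w] still avoids [x], so closing it through [x] gives a cycle.
    Acyclicity leaves that cycle at most two vertices, [x] and [a]. *)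
Lemma neighbours_joined_off_eq (x a : V) (w : seq V) :
  path e a w -> x \notin a :: w -> e x a -> e (last a w) x -> last a w = a.
Proof.
move=> /shortenP[w' aw' uw' sub_w'] xNw exa ewx.
have: ucycle e (x :: a :: w').
  apply/andP; split; first by rewrite /= exa rcons_path aw' ewx.
  rewrite cons_uniq uw' andbT; apply: contra xNw.
  by rewrite !inE => /orP[->//|/sub_w' ->]; rewrite orbT.
by move/acyclic_e; case: w' {aw' uw' sub_w' ewx}.
Qed.

Lemma walk_backtrack (x : V) (p : seq V) :
  path e x p -> ~~ uniq (x :: p) ->
  exists q, [/\ path e x q, last x q = last x p & (size q).+2 = size p].
Proof.
elim: p x => [//|y p IHp] x /= /andP[exy yp].
case: (boolP (uniq (y :: p))) => [uyp|Nu _]; last first.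
  have [q [yq lq sq]] := IHp _ yp Nu.
  by exists (y :: q); rewrite /= exy -sq.
rewrite -/(uniq (y :: p)) uyp andbT negbK inE => /predU1P[xy|x_p].
  by rewrite xy irr_e in exy.
case/splitPr: x_p yp uyp => p1 p2.
rewrite cat_path -cat_cons cat_uniq /= => /and3P[yp1 ep1x xp2].
case/and3P=> /andP[yNp1 _] /norP[xNyp1 _] _.
(* The segment [y :: p1] between the two visits to [x] joins neighbours of [x], so it ends at [y].
   Having no repetition it is [y] alone: the walk begins [x], [y], [x]. *)
have := neighbours_joined_off_eq yp1 xNyp1 exy ep1x.
case: p1 yNp1 {yp1 ep1x xNyp1} => [|z p1] yNp1 /= lp1.
  by exists p2; split.
by move: yNp1; rewrite -{1}lp1 mem_last.
Qed.

(** The second vertices [a] and [b] are neighbours of [x] joined by a walk that avoids [x], hence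
    equal; induction handles the rest. *)
Lemma graph_path_unique (x : V) (p q : seq V) :
  graph_path e x p -> graph_path e x q -> last x p = last x q -> p = q.
Proof.
have last_loop z (s : seq V) : uniq (z :: s) -> last z s = z -> s = [::].
  by case: s => //= t s /andP[zNs _] lz; rewrite -{1}lz mem_last in zNs.
elim: p x q => [|a p IHp] x [|b q] //.
- by move=> _ /andP[_ uq] /esym/(last_loop _ _ uq).
- by move=> /andP[_ up] _ /(last_loop _ _ up).
rewrite /graph_path !cons_uniq => /andP[/= /andP[exa ap] /andP[xNp up]].
move=> /andP[/= /andP[exb bq] /andP[xNq uq]] lpq.
suff ab : b = a.
  by rewrite ab in bq uq lpq *; rewrite (IHp a q) // /graph_path ?ap ?bq.
(* Follow [p] to the common end, then [q] backwards to [b]; [belast] keeps the common end from being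
   listed twice. *)
have lw : last a (p ++ rev (belast b q)) = b.
  by rewrite last_cat lpq; case: (q) => //= c r; rewrite rev_cons last_rcons.
rewrite -[LHS]lw; apply: (@neighbours_joined_off_eq x) => //.
- rewrite cat_path ap lpq rev_path.
  by rewrite (eq_path (e' := e)) // => u v; rewrite sym_e.
- rewrite -cat_cons mem_cat negb_or xNp mem_rev.
  by apply: contra xNq => /mem_belast.
- by rewrite lw sym_e.
Qed.

(** Removing repetitions from the walk gives a path with the same ends, which by uniqueness is
    [p]. *)
Lemma graph_path_shortest (k : nat) (x : V) (p : seq V) :
  graph_path e x p -> walk e k x (last x p) -> (size p <= k)%N.
Proof.
move=> gp [q [xq]]; case/shortenP: xq => q' xq' uq' sub_q' lq <-.
rewrite (@graph_path_unique x p q') ?uniq_leq_size //.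
  by case/andP: uq'.
by rewrite /graph_path xq'.
Qed.

End Trees.

(** Supplies the edge at the end of a walk along which it can be lengthened by a backtrack. *)
Lemma connected_neighbour (V : finType) (e : rel V) (a b z : V) :
  (forall x y, connect e x y) -> e a b -> exists t, e z t.
Proof.
move=> conn eab; have /connectP[[|t p] /=] := conn z a; first by move=> _ /= <-; exists b.
by move=> /andP[ezt _] _; exists t.
Qed.

Lemma exists_longest_path (V : finType) (e : rel V) :
  (0 < #|V|)%N -> exists n, longest_path_length e n.
Proof.
case/card_gt0P=> x0 _.
pose P n := [exists x, exists p : n.-tuple V, graph_path e x p].
have PP x p : graph_path e x p -> P (size p).
  by move=> gp; apply/existsP; exists x; apply/existsP; exists (in_tuple p).
have exP : exists n, P n by exists 0; apply: (PP x0 [::]).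
have leP n : P n -> n <= #|V|.
  case/existsP=> x /existsP[p /andP[_ /card_uniqP/= up]].
  by rewrite -ltnS -{1}(size_tuple p) -up (leq_trans (max_card _)).
case: (ex_maxnP exP leP) => n /existsP[x /existsP[p gp]] max_n.
exists n; split; first by exists x, p; rewrite size_tuple.
by move=> y q /PP/max_n.
Qed.

Lemma longest_path_frakD (V : finType) (e : rel V) (n : nat) :
  tree e -> longest_path_length e n -> frakD e n.
Proof.
case=> [[sym_e irr_e] [_ conn] acyc] [[x [p [gp sp]]] max_n]; split.
  case: n sp max_n => [|n] sp max_n.
    apply/beta_stable0P=> u v; apply/negP=> euv.
    have: graph_path e u [:: v].
      rewrite /graph_path /= euv inE !andbT.
      by apply: contraTneq euv => ->; rewrite irr_e.
    by move/max_n.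
  apply/beta_stableSP=> u v; split=> [[q [uq lq sq]]|[q [uq lq sq]]].
    (* The walk has one edge more than a longest path, so it repeats a vertex. *)
    have Nuq : ~~ uniq (u :: q).
      apply/negP=> Uq; have := max_n u q; rewrite /graph_path uq Uq sq ltnn.
      by move/(_ isT).
    have [r [ur lr sr]] := walk_backtrack irr_e acyc uq Nuq.
    by exists r; split; rewrite ?lr //; apply/eqP; rewrite -2!eqSS sr sq.
  (* The longest path has positive length and so provides an edge. *)
  have [a [b eab]] : exists a b, e a b.
    by case: p sp gp => //= b p _ /andP[/= /andP[exb _] _]; exists x, b.
  have [t evt] := connected_neighbour v conn eab.
  exists (q ++ [:: t; v]); rewrite cat_path last_cat size_cat /= uq lq evt sq addn2.
  by rewrite sym_e evt.
(* Minimality: for [k < n], test stability on the ends of the initial segment of length [k.+1] of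
   the longest path. *)
move=> k; case: (ltnP k n) => // lt_kn st.
have gt : graph_path e x (take k.+1 p).
  case/andP: gp => xp up; rewrite /graph_path take_path //.
  exact: (take_uniq k.+2 up).
have szt : size (take k.+1 p) = k.+1 by rewrite size_takel // sp.
have wt : walk e k.+1 x (last x (take k.+1 p)).
  by exists (take k.+1 p); split=> //; case/andP: gt.
case: k st {lt_kn} gt szt wt => [/beta_stable0P noe|k /beta_stableSP st] gt szt wt.
  by case/walkS: wt => z; rewrite (negbTE (noe x z)).
(* With [k] now standing for its predecessor, stability turns the path of length [k.+2] into a walk
   of length [k] with the same ends. *)
have := graph_path_shortest sym_e acyc gt (proj1 (st _ _) wt).
by rewrite szt => /ltnW; rewrite ltnn.
Qed.

Theorem theorem1 (V : finType) (e : rel V) (tree_e : tree e) :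
  (forall n : nat,
      longest_path_length e n <->
      (beta_stable e n /\ forall k : nat, beta_stable e k -> (n <= k)%N)) /\
  (exists d : nat, frakD e d /\ longest_path_length e d).
Proof.
have [_ [V_gt0 _] _] := tree_e.
have [d long_d] := exists_longest_path e V_gt0.
have min_d := longest_path_frakD tree_e long_d.
split; last by exists d.
move=> n; split=> [/(longest_path_frakD tree_e)//|[st_n min_n]].
(* Both [n] and the longest length [d] are minima of the same set. *)
suff -> : n = d by [].
by apply/anti_leq; rewrite min_n ?(proj2 min_d) //; case: min_d.
Qed.
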